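(* Let $a\in\mathbb{Z}^n$ with $a_i>0$ for all $i$ and $\gcd(a_1,\dots,a_n)=1$. Suppose $a=M_1p^1+M_2p^2$ with $M_1,M_2\in\mathbb{Z}_{>0}$ and $p^1,p^2\in\mathbb{Z}^n$, and suppose that the $2\times n$ matrix $P$ with rows $p^1,p^2$ has Hermite Normal Form $(I,0)$. Let $q_1,q_2\in\mathbb{Z}$ satisfy $M_1q_1+M_2q_2=1$, and let $b$ be a nonnegative integer. Let $$V_+=\{(x,\mu)\in\mathbb{R}^n_+\times\mathbb{R}\mid p^1x-M_2\mu=q_1b,\ p^2x+M_1\mu=q_2b\}.$$ Let $k$ be an index $i$ maximizing $p^1_i/a_i$ and $j$ an index $i$ minimizing $p^1_i/a_i$ over $1\le i\le n$. Then the integer width of $V_+$ in the direction of the last coordinate $\mu$ is $$w_I(V_+,e^{n+1})=\left\lfloor\frac{bp^1_k}{M_2a_k}-\frac{bq_1}{M_2}\right\rfloor-\left\lceil\frac{bp^1_j}{M_2a_j}-\frac{bq_1}{M_2}\right\rceil+1.$$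
   Context: $\mathbb{R}^n_+$ is the nonnegative orthant, and $e^{n+1}$ is the unit vector in $\mathbb{R}^{n+1}$ corresponding to the coordinate $\mu$. The products $p^ix$ denote inner products. The integer width of a rational polytope $P'$ in an integer direction $d$ is $$w_I(P',d)=\lfloor\max\{d^Tx\mid x\in P'\}\rfloor-\lceil\min\{d^Tx\mid x\in P'\}\rceil+1.$$ The Hermite Normal Form of $P$ being $(I,0)$ means that there is an $n\times n$ unimodular integer matrix $U$ with $PU=(I,0)$. *)

(* Defs.v *)
From mathcomp Require Import all_boot all_order all_algebra.
From mathcomp Require Import boolp classical_sets reals.

Set Implicit Arguments.
Unset Strict Implicit.
Unset Printing Implicit Defensive.

Import Order.TTheory GRing.Theory Num.Theory.

Local Open Scope classical_set_scope.
Local Open Scope ring_scope.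

Definition idot (R : realType) (n : nat) (p : 'rV[int]_n) (x : 'cV[R]_n) : R :=
  \sum_(i < n) (p 0 i)%:~R * x i 0.

Definition is_max (R : realType) (A : set R) (M : R) : Prop :=
  A M /\ forall y, A y -> y <= M.

Definition is_min (R : realType) (A : set R) (m : R) : Prop :=
  A m /\ forall y, A y -> m <= y.

(* [is_integer_width P' d w] asserts that both extrema defining the integer
   width are attained and that the width equals [w]; since the extrema are
   unique, at most one [w] qualifies. *)
Definition is_integer_width (R : realType) (m : nat) (P' : set 'cV[R]_m)
    (d : 'cV[int]_m) (w : int) : Prop :=
  exists hi lo : R,
    [/\ is_max [set idot d^T x | x in P'] hi,
        is_min [set idot d^T x | x in P'] lo
      & w = Num.floor hi - Num.ceil lo + 1].

(* [pid_mx m] is the block matrix (I, 0) only when [m <= n]; otherwise it would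
   be a truncated identity, hence the explicit bound. *)
Definition hnf_is_I0 (m n : nat) (P : 'M[int]_(m, n)) : Prop :=
  (m <= n)%N /\ exists2 U : 'M[int]_n, U \in unitmx & P *m U = pid_mx m.

(* A point (x, mu) of R^n x R is a column vector of height n + 1: [usubmx]
   extracts x and [dsubmx] extracts mu. *)
Definition Vplus (R : realType) (n : nat) (p1 p2 : 'rV[int]_n)
    (M1 M2 q1 q2 b : int) : set 'cV[R]_(n + 1) :=
  [set v : 'cV[R]_(n + 1) | let x : 'cV[R]_n := usubmx v in let mu : R := dsubmx v 0 0 in
    [/\ forall i, 0 <= x i 0,
        idot p1 x - M2%:~R * mu = (q1 * b)%:~R
      & idot p2 x + M1%:~R * mu = (q2 * b)%:~R]].

Arguments Vplus R {n} p1 p2 M1 M2 q1 q2 b _.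

Definition e_last (n : nat) : 'cV[int]_(n + 1) := delta_mx (rshift n 0) 0.

(* Main.v *)
Require Import Defs.
From mathcomp Require Import all_boot all_order all_algebra.
From mathcomp Require Import boolp classical_sets reals.
From mathcomp Require Import ring.

Import Order.TTheory GRing.Theory Num.Theory.

Local Open Scope classical_set_scope.
Local Open Scope ring_scope.

(** Combining the two equations that define [V_+] with weights [M1, M2]
    eliminates [mu] and leaves the single constraint [a x = b], because
    [M1 q1 + M2 q2 = 1]; the first equation then only says that
    [mu = (p1 x - q1 b) / M2] ([mem_VplusP]). Hence the [mu]-coordinates of [V_+]
    are the values of this affine function of [p1 x] on the simplex
    [{x >= 0 | a x = b}].

    On that simplex [p1 x] is the sum of the [(p1_i / a_i) (a_i x_i)], where the
    weights [a_i x_i] are nonnegative and add up to [b]. It therefore lies between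
    [b] times the least and [b] times the largest ratio [p1_i / a_i]
    ([idot_le_ratio], [idot_ge_ratio]), and the vertices [(b / a_j) e_j] and
    [(b / a_k) e_k] attain these bounds ([mem_Vplus_vertex]). The integer width
    is then read off from these two extreme values of [mu]. *)

Section Idot.
Variable R : realType.

Lemma idot_delta (n : nat) (i : 'I_n) (x : 'cV[R]_n) :
  idot (delta_mx i 0)^T x = x i 0.
Proof.
rewrite /idot (bigD1 i) //= !mxE !eqxx mul1r big1 ?addr0 // => l li.
by rewrite !mxE (negPf li) mul0r.
Qed.

Lemma idot_scale_delta (n : nat) (p : 'rV[int]_n) (c : R) (i : 'I_n) :
  idot p (c *: delta_mx i 0) = (p 0 i)%:~R * c.
Proof.
rewrite /idot (bigD1 i) //= !mxE !eqxx mulr1 big1 ?addr0 // => l li.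
by rewrite !mxE (negPf li) !mulr0.
Qed.

Lemma idot_comb (n : nat) (c d : int) (p q : 'rV[int]_n) (x : 'cV[R]_n) :
  idot (c *: p + d *: q) x = c%:~R * idot p x + d%:~R * idot q x.
Proof.
rewrite /idot !mulr_sumr -big_split /=; apply: eq_bigr => i _.
by rewrite !mxE intrD !intrM; ring.
Qed.

Section Ratio.
Variables (n : nat) (p a : 'rV[int]_n) (r : R) (x : 'cV[R]_n).
Hypothesis a_gt0 : forall i, 0 < a 0 i.
Hypothesis x_ge0 : forall i, 0 <= x i 0.

(** Each [p_i] is at most [r a_i], and nonnegative weights preserve this
    inequality when the terms are added. *)
Lemma idot_le_ratio :
  (forall i, (p 0 i)%:~R / (a 0 i)%:~R <= r) -> idot p x <= r * idot a x.
Proof.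
move=> p_le; rewrite /idot mulr_sumr; apply: ler_sum => i _.
by rewrite mulrA ler_wpM2r // -ler_pdivrMr ?ltr0z.
Qed.

Lemma idot_ge_ratio :
  (forall i, r <= (p 0 i)%:~R / (a 0 i)%:~R) -> r * idot a x <= idot p x.
Proof.
move=> p_ge; rewrite /idot mulr_sumr; apply: ler_sum => i _.
by rewrite mulrA ler_wpM2r // -ler_pdivlMr ?ltr0z.
Qed.

End Ratio.
End Idot.

Section SimplexDescription.
Variables (R : realType) (n : nat) (a p1 p2 : 'rV[int]_n).
Variables (M1 M2 q1 q2 b : int).
Hypothesis a_gt0 : forall i, 0 < a 0 i.
Hypothesis M2_gt0 : 0 < M2.
Hypothesis a_def : a = M1 *: p1 + M2 *: p2.
Hypothesis q_bezout : M1 * q1 + M2 * q2 = 1.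
Hypothesis b_ge0 : 0 <= b.

(** The change from the two equations to [a x = b] and the formula for [mu] is
    invertible because [M2] is nonzero, so [V_+] is the graph of an affine
    function over the simplex [{x >= 0 | a x = b}]. *)
Lemma mem_VplusP (v : 'cV[R]_(n + 1)) :
  Vplus R p1 p2 M1 M2 q1 q2 b v <->
  [/\ forall i, 0 <= usubmx v i 0,
      idot a (usubmx v) = b%:~R
    & dsubmx v 0 0 = (idot p1 (usubmx v) - (q1 * b)%:~R) / M2%:~R].
Proof.
have M2_neq0 : M2%:~R != 0 :> R by rewrite intr_eq0 gt_eqF.
have q2E : M2%:~R * q2%:~R = 1 - M1%:~R * q1%:~R :> R.
  by apply/eqP; rewrite eq_sym subr_eq addrC -!intrM -intrD q_bezout.
rewrite /Vplus /= a_def idot_comb !intrM.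
set x := usubmx v; set mu := dsubmx v 0 0.
split=> [[x_ge0 eq1 eq2] | [x_ge0 ax mu_def]]; split=> //.
- (* [M1] times the first equation plus [M2] times the second *)
  have -> : idot p1 x = q1%:~R * b%:~R + M2%:~R * mu by rewrite -eq1; ring.
  have -> : idot p2 x = q2%:~R * b%:~R - M1%:~R * mu by rewrite -eq2; ring.
  by rewrite mulrBr [M2%:~R * (_ * b%:~R)]mulrA q2E; ring.
- by rewrite -eq1; field.
- by rewrite mu_def; field.
- apply: (mulfI M2_neq0); rewrite [RHS]mulrA q2E mulrBl -mulrA mul1r mu_def -ax.
  by field.
Qed.

(** The value of [mu] over the vertex [(b / a_i) e_i] of the simplex. *)
Definition vertex_mu (i : 'I_n) : R :=
  b%:~R * (p1 0 i)%:~R / (M2%:~R * (a 0 i)%:~R) - b%:~R * q1%:~R / M2%:~R.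

Lemma vertex_muE (i : 'I_n) :
  vertex_mu i =
  ((p1 0 i)%:~R / (a 0 i)%:~R * b%:~R - (q1 * b)%:~R) / M2%:~R.
Proof.
have M2_neq0 : M2%:~R != 0 :> R by rewrite intr_eq0 gt_eqF.
have ai_neq0 : (a 0 i)%:~R != 0 :> R by rewrite intr_eq0 gt_eqF.
by rewrite /vertex_mu intrM; field; rewrite M2_neq0.
Qed.

Lemma mem_Vplus_vertex (i : 'I_n) :
  Vplus R p1 p2 M1 M2 q1 q2 b
    (col_mx ((b%:~R / (a 0 i)%:~R) *: delta_mx i 0) (vertex_mu i)%:M).
Proof.
have ai_neq0 : (a 0 i)%:~R != 0 :> R by rewrite intr_eq0 gt_eqF.
apply/mem_VplusP; rewrite col_mxKu col_mxKd !idot_scale_delta; split.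
- move=> l; rewrite !mxE mulr_ge0 ?ler0n //.
  by rewrite divr_ge0 ?ler0z // ltW.
- by rewrite mulrC divfK.
- by rewrite mxE eqxx mulr1n vertex_muE mulrAC mulrA.
Qed.

Lemma vertex_mu_in_image (i : 'I_n) :
  [set idot (e_last n)^T v | v in Vplus R p1 p2 M1 M2 q1 q2 b] (vertex_mu i).
Proof.
exists (col_mx ((b%:~R / (a 0 i)%:~R) *: delta_mx i 0) (vertex_mu i)%:M).
  exact: mem_Vplus_vertex.
by rewrite idot_delta col_mxEd mxE eqxx mulr1n.
Qed.

Lemma idot_e_last_Vplus (v : 'cV[R]_(n + 1)) :
  Vplus R p1 p2 M1 M2 q1 q2 b v ->
  idot (e_last n)^T v = (idot p1 (usubmx v) - (q1 * b)%:~R) / M2%:~R.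
Proof. by move=> /mem_VplusP[_ _ <-]; rewrite idot_delta mxE. Qed.

Lemma vertex_mu_is_max (k : 'I_n) :
  (forall i, (p1 0 i)%:~R / (a 0 i)%:~R <= (p1 0 k)%:~R / (a 0 k)%:~R :> R) ->
  is_max [set idot (e_last n)^T v | v in Vplus R p1 p2 M1 M2 q1 q2 b]
    (vertex_mu k).
Proof.
move=> k_max; split=> [|_ [v vV <-]]; first exact: vertex_mu_in_image.
have /mem_VplusP[x_ge0 ax _] := vV.
rewrite idot_e_last_Vplus // vertex_muE ler_pM2r ?invr_gt0 ?ltr0z //.
by rewrite lerB // -ax; apply: idot_le_ratio.
Qed.

Lemma vertex_mu_is_min (j : 'I_n) :
  (forall i, (p1 0 j)%:~R / (a 0 j)%:~R <= (p1 0 i)%:~R / (a 0 i)%:~R :> R) ->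
  is_min [set idot (e_last n)^T v | v in Vplus R p1 p2 M1 M2 q1 q2 b]
    (vertex_mu j).
Proof.
move=> j_min; split=> [|_ [v vV <-]]; first exact: vertex_mu_in_image.
have /mem_VplusP[x_ge0 ax _] := vV.
rewrite idot_e_last_Vplus // vertex_muE ler_pM2r ?invr_gt0 ?ltr0z //.
by rewrite lerB // -ax; apply: idot_ge_ratio.
Qed.

End SimplexDescription.

Theorem theorem7 (R : realType) (n : nat) (a p1 p2 : 'rV[int]_n)
    (M1 M2 q1 q2 b : int) (k j : 'I_n)
    (ha : forall i, 0 < a 0 i)
    (hgcd : \big[gcdz/0]_(i < n) a 0 i = 1)
    (hM1 : 0 < M1) (hM2 : 0 < M2)
    (hdec : a = M1 *: p1 + M2 *: p2)
    (hhnf : hnf_is_I0 (col_mx p1 p2))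
    (hq : M1 * q1 + M2 * q2 = 1)
    (hb : 0 <= b)
    (hk : forall i, (p1 0 i)%:~R / (a 0 i)%:~R <= (p1 0 k)%:~R / (a 0 k)%:~R :> R)
    (hj : forall i, (p1 0 j)%:~R / (a 0 j)%:~R <= (p1 0 i)%:~R / (a 0 i)%:~R :> R) :
  is_integer_width (Vplus R p1 p2 M1 M2 q1 q2 b) (e_last n)
    (Num.floor (b%:~R * (p1 0 k)%:~R / (M2%:~R * (a 0 k)%:~R)
                - b%:~R * q1%:~R / M2%:~R : R)
     - Num.ceil (b%:~R * (p1 0 j)%:~R / (M2%:~R * (a 0 j)%:~R)
                - b%:~R * q1%:~R / M2%:~R : R)
     + 1).
Proof.
exists (vertex_mu R n a p1 M2 q1 b k), (vertex_mu R n a p1 M2 q1 b j).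
split=> //; [exact: vertex_mu_is_max | exact: vertex_mu_is_min].
Qed.
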